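(* Let $F$ be the $N\times N$ non-normalized discrete Fourier transform matrix, explicitly, $F_{k\ell}:=e^{2\pi\mathrm ik\ell/N}$ for each $k,\ell=0,\dots,N-1$. Next, let $\{B_i\}_{i=0}^{N-1}$ be a collection of independent Bernoulli random variables with mean $\frac MN$, and take $\mathcal M:=\{i:B_i=1\}$. Finally, construct an $|\mathcal M|\times N$ harmonic frame $\Phi$ by collecting rows of $F$ which correspond to indices in $\mathcal M$ and normalizing the columns. Then $\Phi$ is a unit norm tight frame: $\|\Phi\|_2^2=\frac{N}{|\mathcal M|}$. Also, provided $16\log N\le M\le\frac N3$, the following simultaneously hold with probability exceeding $1-4N^{-1}-N^{-2}$: (i) $\frac12M\le|\mathcal M|\le\frac32M$, (ii) $\nu\le\frac{\mu}{\sqrt{|\mathcal M|}}$, (iii) $\mu\le\sqrt{\frac{118(N-M)\log N}{MN}}$.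
   Context: $\log$ is the natural logarithm; $\|\Phi\|_2$ is the spectral norm. Bernoulli random variables take values in $\{0,1\}$. A unit norm tight frame is a full-rank matrix with unit-norm columns whose rows are pairwise orthogonal with equal norms (the construction of $\Phi$ presumes $\mathcal M\ne\emptyset$). For $\Phi$ with columns $\varphi_1,\dots,\varphi_N$, the worst-case coherence is $\mu:=\max_{i\ne j}|\langle\varphi_i,\varphi_j\rangle|$ and the average coherence is $\nu:=\max_i\left|\frac1{N-1}\sum_{j\ne i}\langle\varphi_i,\varphi_j\rangle\right|$. *)

(* Defs.v *)
From mathcomp Require Export all_boot all_order all_algebra.
From mathcomp Require Export complex.
From mathcomp Require Export all_classical all_reals all_analysis.
Export Order.TTheory GRing.Theory Num.Theory numFieldNormedType.Exports.

Set Implicit Arguments.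
Unset Strict Implicit.
Unset Printing Implicit Defensive.

Local Open Scope classical_set_scope.
Local Open Scope complex_scope.
Local Open Scope ring_scope.

Section Frames.
Variable R : realType.
Implicit Types m n N : nat.

(* e^{it}, by Euler's formula *)
Definition expi (t : R) : R[i] := cos t +i* sin t.

Definition inner n (u v : 'cV[R[i]]_n) : R[i] := dotmx u^T v^T.

(* Real-valued, unlike the norm of the numFieldType R[i], which lies in R[i]. *)
Definition l2norm n (v : 'cV[R[i]]_n) : R :=
  Num.sqrt (\sum_(i < n) ComplexField.Normc.normc (v i 0) ^+ 2).

Definition spectral_norm m n (A : 'M[R[i]]_(m, n)) : R :=
  sup [set l2norm (A *m x) | x in [set x : 'cV[R[i]]_n | l2norm x <= 1]].

Definition unit_norm_tight_frame m n (A : 'M[R[i]]_(m, n)) : Prop :=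
  [/\ \rank A = minn m n,
      forall j, l2norm (col j A) = 1,
      forall i i', i != i' -> dotmx (row i A) (row i' A) = 0
    & forall i i', l2norm (row i A)^T = l2norm (row i' A)^T].

Definition worst_case_coherence m n (A : 'M[R[i]]_(m, n)) : R :=
  \big[Num.max/0]_(i < n) \big[Num.max/0]_(j < n | j != i)
    ComplexField.Normc.normc (inner (col i A) (col j A)).

Definition average_coherence m n (A : 'M[R[i]]_(m, n)) : R :=
  \big[Num.max/0]_(i < n)
    ComplexField.Normc.normc
      (n.-1%:R^-1 * \sum_(j < n | j != i) inner (col i A) (col j A)).

Definition dft N : 'M[R[i]]_N :=
  \matrix_(k < N, l < N) expi (2 * pi * k%:R * l%:R / N%:R).

Definition normalize_columns m n (A : 'M[R[i]]_(m, n)) : 'M[R[i]]_(m, n) :=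
  \matrix_(i, j) (A i j / (l2norm (col j A))%:C).

(* [enum_val] lists the elements of A in increasing order. *)
Definition harmonic_frame N (A : {set 'I_N}) : 'M[R[i]]_(#|A|, N) :=
  normalize_columns (rowsub (fun k : 'I_#|A| => enum_val k) (dft N)).

End Frames.

Section Bernoulli.
Context (d : measure_display) (T : measurableType d) (R : realType).
Context (P : probability T R).

Definition mutually_independent (I : finType) (X : I -> {RV P >-> R}) : Prop :=
  forall (J : {set I}) (A : I -> set R), (forall i, measurable (A i)) ->
    P (\bigcap_(i in [set` J]) (X i @^-1` A i)) =
    (\prod_(i in J) P (X i @^-1` A i))%E.

Definition bernoulli_variable (p : R) (X : {RV P >-> R}) : Prop :=
  (forall w, X w = 0 \/ X w = 1) /\ ('E_P[X] = p%:E)%E.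

Definition selected N (B : 'I_N -> {RV P >-> R}) (w : T) : {set 'I_N} :=
  finset (fun i => B i w == 1).

End Bernoulli.

(* Main.v *)
Require Import Defs.
From mathcomp Require Import ring lra.

(** Write m for the size of the random set S of selected rows, p = M/N for the
    selection probability and L for ln N.

    Deterministic part.  The frame Phi obtained from S satisfies
    Phi Phi^* = (N/m) I, because distinct rows of the Fourier matrix are
    orthogonal.  This identity alone makes Phi a tight frame with squared
    spectral norm N/m ([spectral_norm_coisometry]), and computing the trace of
    (Phi^* Phi)^2 in two ways gives the Welch bound
    mu^2 >= (N - m) / (m (N - 1)) ([welch_bound]).  Row 0 of the Fourier matrix
    is constant and the other rows sum to zero, so nu is known exactly: it is
    (N/m - 1) / (N - 1) if row 0 is selected and 1 / (N - 1) otherwise.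
    Comparing with the Welch bound, (ii) holds for every S with m <= N/2, hence
    whenever (i) holds, since then m <= 3M/2 <= N/2.

    Random part.  By independence, P(selected = S) is the product of p over S
    and of 1 - p over its complement ([prob_selected]), so all probabilities
    are finite sums over subsets.  For weights |c_i| <= 1, the exponential
    moment of the deviation of sum_(i in S) c_i from its mean factors over i,
    and e^x <= 1 + x + x^2 for x <= 1/2 bounds each factor; Markov's inequality
    gives a deviation of u or more probability at most
    exp (s^2 v - s u), where v = p (1 - p) N and 0 <= s <= 1/2
    ([subset_tail]).
    - With c = 1, s = 1/4 and u = M/2, (i) fails with probability at most
      2 exp (- M/16) <= 2/N.
    - For columns i <> j, m <phi_i, phi_j> is a sum over S of unimodular
      numbers whose sum over all rows vanishes.  Applying the tail bound to
      real and imaginary parts with u about sqrt (29.5 v L / 2) and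
      s = (3/2) sqrt (L/v), each pair violates (iii) with probability at most
      4 exp (- 3.51 L) <= 2/N^3; there are at most N^2 pairs.
    Altogether the failure probability is at most 4/N ([prob_good_subset]),
    which is strictly better than required.  For N <= 4 the required
    probability is negative. *)

Set Implicit Arguments.
Unset Strict Implicit.
Unset Printing Implicit Defensive.

Local Open Scope classical_set_scope.
Local Open Scope ring_scope.

(** * Tight frames and the Welch bound *)

Section TightFrames.
Variable R : realType.
Local Notation normc := ComplexField.Normc.normc.
Local Notation "x %:C" := (real_complex R x) : ring_scope.
Local Notation adj A := (map_mx Num.conj (trmx A)).

Lemma normcE (z : R[i]) : (normc z)%:C = `|z|. Proof. by []. Qed.

Lemma normc_ge0 (z : R[i]) : 0 <= normc z.
Proof. by case: z => a b; exact: sqrtr_ge0. Qed.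

Lemma sqr_normcE (z : R[i]) : (normc z ^+ 2)%:C = z * z^*.
Proof. by rewrite rmorphXn /= normcE normCK. Qed.

Lemma conj_real (x : R) : Num.conj x%:C = x%:C.
Proof. exact: conjc_real. Qed.

Lemma sqr_l2norm n (v : 'cV[R[i]]_n) :
  (l2norm v ^+ 2)%:C = (adj v *m v) 0 0.
Proof.
rewrite /l2norm sqr_sqrtr; last by apply: sumr_ge0 => i _; exact: sqr_ge0.
rewrite rmorph_sum mxE; apply: eq_bigr => i _ /=.
by rewrite sqr_normcE !mxE mulrC.
Qed.

Lemma l2norm_ge0 n (v : 'cV[R[i]]_n) : 0 <= l2norm v.
Proof. exact: sqrtr_ge0. Qed.

Lemma adjmxM m n p (A : 'M[R[i]]_(m, n)) (B : 'M[R[i]]_(n, p)) :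
  adj (A *m B) = adj B *m adj A.
Proof. by rewrite trmx_mul map_mxM. Qed.

Lemma adjmxK m n (A : 'M[R[i]]_(m, n)) : adj (adj A) = A.
Proof. by apply/matrixP => i j; rewrite !mxE conjCK. Qed.

Lemma adjmxB m n (A B : 'M[R[i]]_(m, n)) : adj (A - B) = adj A - adj B.
Proof. by rewrite linearB map_mxB. Qed.

Lemma adjmxZ m n (a : R) (A : 'M[R[i]]_(m, n)) :
  adj (a%:C *: A) = a%:C *: adj A.
Proof.
by apply/matrixP => i j; rewrite !mxE rmorphM; congr (_ * _); exact: conj_real.
Qed.

Lemma inner_colE m n (A : 'M[R[i]]_(m, n)) i j :
  inner (col i A) (col j A) = \sum_k A k i * (A k j)^*.
Proof. by rewrite /inner dotmxE !mxE; apply: eq_bigr => k _; rewrite !mxE. Qed.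

Lemma gram_rowE m n (A : 'M[R[i]]_(m, n)) i j :
  (A *m adj A) i j = \sum_k A i k * (A j k)^*.
Proof. by rewrite mxE; apply: eq_bigr => k _; rewrite !mxE. Qed.

Lemma sqr_l2norm_col m n (A : 'M[R[i]]_(m, n)) j :
  (l2norm (col j A) ^+ 2)%:C = inner (col j A) (col j A).
Proof.
rewrite sqr_l2norm inner_colE mxE; apply: eq_bigr => k _.
by rewrite !mxE mulrC.
Qed.

Lemma inner_col_gram m n (A : 'M[R[i]]_(m, n)) i j :
  inner (col i A) (col j A) = (adj A *m A) j i.
Proof.
by rewrite inner_colE mxE; apply: eq_bigr => k _; rewrite !mxE mulrC.
Qed.

Lemma le_worst_case_coherence m n (A : 'M[R[i]]_(m, n)) i j : j != i ->
  normc (inner (col i A) (col j A)) <= worst_case_coherence A.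
Proof.
move=> ji; rewrite /worst_case_coherence.
apply: le_trans (le_bigmax _ _ i).
exact: (le_bigmax_cond _ (fun j => normc (inner (col i A) (col j A)))).
Qed.

Section ScaledCoisometry.
Variables (m n : nat) (A : 'M[R[i]]_(m, n)) (c : R).
Hypothesis AAc : A *m adj A = (c%:C)%:M.

(** A is sqrt c times a coisometry, so c^-1 A^* A is the orthogonal projection
    onto the row space; the squared distance of x to that space is
    |x|^2 - c^-1 |A x|^2, and it is nonnegative. *)
Lemma l2norm_coisometry_le (x : 'cV[R[i]]_n) :
  0 < c -> l2norm (A *m x) ^+ 2 <= c * l2norm x ^+ 2.
Proof.
move=> c0; set y := A *m x.
set r := x - (c^-1)%:C *: (adj A *m y).
suff rE : l2norm r ^+ 2 = l2norm x ^+ 2 - c^-1 * l2norm y ^+ 2.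
  by have := sqr_ge0 (l2norm r); rewrite rE subr_ge0 mulrC ler_pdivrMr // mulrC.
apply: (@complexI R); rewrite rmorphB (rmorphM _ c^-1) !sqr_l2norm /=.
have rt : adj r = adj x - (c^-1)%:C *: (adj y *m A).
  by rewrite /r adjmxB adjmxZ adjmxM adjmxK.
rewrite rt /r mulmxBl !mulmxBr -!scalemxAl -!scalemxAr.
rewrite [adj x *m (_ *m _)]mulmxA -adjmxM -/y -(mulmxA (adj y) A x) -/y.
rewrite -(mulmxA (adj y)) (mulmxA A) AAc mul_scalar_mx -!scalemxAr scalerA.
rewrite -rmorphM mulVf ?gt_eqF // rmorph1 scale1r subrr subr0.
by rewrite !sqr_l2norm !mxE.
Qed.

Lemma spectral_norm_coisometry :
  0 < c -> (0 < m)%N -> spectral_norm A ^+ 2 = c.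
Proof.
move=> c0 m0.
suff -> : spectral_norm A = Num.sqrt c by rewrite sqr_sqrtr ?(ltW c0).
have ubA : ubound [set l2norm (A *m x) | x in [set x | l2norm x <= 1]]
    (Num.sqrt c).
  move=> _ [x /= x1 <-]; rewrite -(ger0_norm (l2norm_ge0 _)).
  rewrite -sqrtr_sqr ler_sqrt ?(ltW c0) //.
  apply: le_trans (l2norm_coisometry_le x c0) _.
  by rewrite ler_piMr ?(ltW c0) // expr_le1 ?l2norm_ge0.
(* The norm is attained at a normalized adjoint row of A. *)
pose e : 'cV[R[i]]_m := delta_mx (Ordinal m0) 0.
pose x := ((Num.sqrt c)^-1)%:C *: (adj A *m e).
have sc0 : Num.sqrt c != 0 by rewrite gt_eqF // sqrtr_gt0.
have e1 : adj e *m e = 1%:M.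
  apply/matrixP => i j; rewrite !mxE (bigD1 (Ordinal m0)) //= big1.
    by rewrite !mxE !eqxx !ord1 !eqxx /= rmorph1 mulr1 addr0.
  by move=> k /negbTE k0; rewrite !mxE k0 mulr0.
have adjx : adj x = ((Num.sqrt c)^-1)%:C *: (adj e *m A).
  by rewrite /x adjmxZ adjmxM adjmxK.
have Ax : A *m x = (Num.sqrt c)%:C *: e.
  rewrite -scalemxAr mulmxA AAc mul_scalar_mx scalerA -rmorphM /=.
  by rewrite -{2}(sqr_sqrtr (ltW c0)) expr2 mulKf.
have x1 : l2norm x = 1.
  apply/eqP; rewrite -(@eqrXn2 _ 2) ?l2norm_ge0 // expr1n.
  apply/eqP/(@complexI R); rewrite sqr_l2norm adjx -scalemxAl -mulmxA Ax.
  by rewrite -scalemxAr scalerA -rmorphM mulVf //= e1 !mxE eqxx mulr1.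
have Axc : l2norm (A *m x) = Num.sqrt c.
  apply/eqP; rewrite -(@eqrXn2 _ 2) ?l2norm_ge0 ?sqrtr_ge0 //.
  apply/eqP/(@complexI R); rewrite sqr_l2norm Ax adjmxZ -scalemxAl.
  rewrite -scalemxAr e1 scalerA !mxE eqxx mulr1.
  by rewrite -[_ * _]rmorphM -expr2.
apply/le_anti/andP; split.
  by apply: ge_sup ubA; exists (l2norm (A *m x)), x => //=; rewrite x1.
by apply: ub_le_sup; [exists (Num.sqrt c) | exists x; rewrite //= x1].
Qed.

Lemma unit_norm_tight_frame_coisometry :
  0 < c -> (forall j, l2norm (col j A) = 1) -> unit_norm_tight_frame A.
Proof.
move=> c0 A1.
have dotE i i' : dotmx (row i A) (row i' A) = c%:C *+ (i == i').
  have /matrixP/(_ i i') := AAc; rewrite !mxE => <-.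
  by rewrite dotmxE !mxE; apply: eq_bigr => k _; rewrite !mxE.
have rA : \rank A = m.
  apply/eqP/row_freeP; exists ((c^-1)%:C *: adj A).
  rewrite -scalemxAr AAc scale_scalar_mx -rmorphM mulVf ?gt_eqF //.
split => //.
- by rewrite rA; apply/esym/minn_idPl; rewrite -rA rank_leq_col.
- by move=> i i' /negbTE ii'; rewrite dotE ii'.
- suff rowE i : l2norm (row i A)^T ^+ 2 = c.
    by move=> i i'; apply/eqP; rewrite -(@eqrXn2 _ 2) ?l2norm_ge0 // !rowE.
  apply: (@complexI R); rewrite sqr_l2norm.
  have := dotE i i; rewrite eqxx /= dotmxE mulr1n => <-.
  by rewrite !mxE; apply: eq_bigr => k _; rewrite !mxE mulrC.
Qed.

Lemma coisometry_trace : (forall j, l2norm (col j A) = 1) -> c * m%:R = n%:R.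
Proof.
move=> A1; apply: (@complexI R); rewrite rmorphM /= !rmorph_nat.
rewrite mulr_natr -mxtrace_scalar -AAc mxtrace_mulC /mxtrace.
rewrite (eq_bigr (fun=> 1)) ?sumr_const ?card_ord // => j _.
by rewrite -inner_col_gram -sqr_l2norm_col A1 expr1n.
Qed.

(** The squared moduli of all Gram entries sum to the trace of (A^* A)^2, which
    is that of (A A^* )^2, namely c^2 m = c n.  The diagonal contributes n and
    each of the n (n - 1) other entries at most the squared coherence. *)
Lemma welch_bound : (0 < m)%N -> (1 < n)%N ->
  (forall j, l2norm (col j A) = 1) ->
  (n%:R - m%:R) / (m%:R * n.-1%:R) <= worst_case_coherence A ^+ 2.
Proof.
move=> m0 n1 A1.
set mu := worst_case_coherence A.
have tr := coisometry_trace A1.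
have sumE : \sum_i \sum_j normc (inner (col i A) (col j A)) ^+ 2 = c * n%:R.
  apply: (@complexI R).
  have -> : (c * n%:R)%:C = \tr (adj A *m A *m (adj A *m A)).
    rewrite mulmxA -(mulmxA (adj A)) AAc mul_mx_scalar -scalemxAl mxtraceZ.
    rewrite mxtrace_mulC AAc mxtrace_scalar -tr !rmorphM /= rmorph_nat.
    by rewrite mulr_natr.
  rewrite /mxtrace rmorph_sum; apply: eq_bigr => i _.
  rewrite rmorph_sum mxE; apply: eq_bigr => j _ /=.
  rewrite sqr_normcE !inner_col_gram mulrC; congr (_ * _).
  rewrite !mxE rmorph_sum; apply: eq_bigr => k _.
  by rewrite !mxE rmorphM /= conjCK mulrC.
have : c * n%:R <= n%:R + n%:R * n.-1%:R * mu ^+ 2.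
  rewrite -sumE.
  have -> : n%:R + n%:R * n.-1%:R * mu ^+ 2 =
      \sum_(i < n) (1 + \sum_(j < n | j != i) mu ^+ 2).
    rewrite (eq_bigr (fun=> 1 + n.-1%:R * mu ^+ 2)); last first.
      move=> i _; rewrite sumr_const cardC1 card_ord.
      by rewrite mulr_natl.
    by rewrite sumr_const card_ord -[RHS]mulr_natl mulrDr mulr1 mulrA.
  apply: ler_sum => i _; rewrite (bigD1 i) //= lerD //.
    by rewrite -sqr_l2norm_col A1 expr1n ComplexField.Normc.normc1 expr1n.
  apply: ler_sum => j ji; rewrite lerXn2r ?nnegrE ?normc_ge0 //.
    exact: le_trans (normc_ge0 _) (le_worst_case_coherence A ji).
  exact: le_worst_case_coherence.
have n1' : n.-1%:R = n%:R - 1 :> R.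
  by rewrite -[in RHS](prednK (ltnW n1)) -natr1 addrK.
have m0' : 0 < m%:R :> R by rewrite ltr0n.
have n0' : 0 < n%:R :> R by rewrite ltr0n ltnW.
have nn0 : 0 < n.-1%:R :> R by rewrite ltr0n -subn1 subn_gt0.
rewrite ler_pdivrMr ?mulr_gt0 // => H.
have {}H : n%:R * (m%:R * c) <= n%:R * (m%:R * (1 + n.-1%:R * mu ^+ 2)).
  by rewrite ![n%:R * (m%:R * _)]mulrCA ler_pM2l //; nra.
move: H; rewrite ler_pM2l // [m%:R * c]mulrC tr; nra.
Qed.

End ScaledCoisometry.
End TightFrames.

(** * Harmonic frames *)

Section Dft.
Variable R : realType.
Local Notation normc := ComplexField.Normc.normc.
Local Notation "x %:C" := (real_complex R x) : ring_scope.
Local Notation adj A := (map_mx Num.conj (trmx A)).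

Lemma expiD (s t : R) : expi (s + t) = expi s * expi t.
Proof.
by rewrite /expi cosD sinD [sin s * cos t + _]addrC.
Qed.

Lemma expi_natmul (t : R) n : expi (t *+ n) = expi t ^+ n.
Proof.
elim: n => [|n IHn]; first by rewrite /expi cos0 sin0.
by rewrite mulrS expiD IHn exprS.
Qed.

Lemma normc_expi (t : R) : normc (expi t) = 1.
Proof. by rewrite /= cos2Dsin2 sqrtr1. Qed.

(** By the half-angle formula, cos t = 1 - 2 sin^2 (t/2), and t/2 lies in
    ]0, pi[ where the sine is positive. *)
Lemma expi_neq1 (t : R) : 0 < t < pi *+ 2 -> expi t != 1.
Proof.
move=> /andP[t0 tpi]; rewrite eq_complex negb_and; apply/orP; left => /=.
have s0 : 0 < sin (t / 2).
  by apply: sin_gt0_pi; rewrite divr_gt0 //= ltr_pdivrMr // mulr_natr.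
rewrite (_ : t = (t / 2) *+ 2); last by rewrite -mulr_natr divfK.
rewrite cos_mulr2n cos2sin2 -subr_eq0.
have : sin (t / 2) ^+ 2 != 0 by rewrite expf_neq0 // gt_eqF.
by apply: contraNneq => e; lra.
Qed.

Variable N : nat.
Hypothesis N_gt0 : (0 < N)%N.

Definition dft_root : R[i] := expi (2 * pi / N%:R).
Local Notation w := dft_root.
Local Notation F := (dft R N).

Lemma dft_root_prim : N.-primitive_root w.
Proof.
have NR : (N%:R : R) != 0 by rewrite pnatr_eq0 -lt0n.
have wN : w ^+ N = 1.
  rewrite /dft_root -expi_natmul -[_ *+ N]mulr_natr divfK // mulrC mulr_natr.
  by rewrite /expi cos2pi sin2pi.
apply/andP; split => //; apply/forallP => i; rewrite unity_rootE; apply/eqP.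
have [->|iN] := eqVneq i.+1 N; first by rewrite wN eqxx.
have lt_iN : (i.+1 < N)%N by rewrite ltn_neqAle iN ltn_ord.
apply/negbTE; rewrite /dft_root -expi_natmul expi_neq1 //; apply/andP; split.
  by rewrite pmulrn_lgt0 // divr_gt0 ?ltr0n // mulr_gt0 // pi_gt0.
rewrite -[_ *+ i.+1]mulr_natr -[pi *+ 2]mulr_natr mulrAC.
rewrite ltr_pdivrMr ?ltr0n // [2 * pi]mulrC.
by rewrite ltr_pM2l ?ltr_nat // mulr_gt0 // pi_gt0.
Qed.

Lemma dftE (k l : 'I_N) : F k l = w ^+ (k * l).
Proof.
rewrite mxE /dft_root -expi_natmul -[_ *+ (k * l)]mulr_natr natrM; congr expi.
rewrite !mulrA.
by rewrite -!mulrA [_ / N%:R]mulrC; congr (_ * (_ * _)); rewrite mulrCA.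
Qed.

Lemma dft_sym (k l : 'I_N) : F k l = F l k.
Proof. by rewrite !dftE mulnC. Qed.

Lemma normc_dft (k l : 'I_N) : normc (F k l) = 1.
Proof. by rewrite mxE normc_expi. Qed.

Lemma dft_mul_conj (k l : 'I_N) : F k l * (F k l)^* = 1.
Proof. by rewrite -sqr_normcE normc_dft expr1n rmorph1. Qed.

(** For k <> k' this is a geometric sum whose ratio is an N-th root of unity
    different from 1. *)
Lemma dft_orthogonal (k k' : 'I_N) :
  \sum_(l < N) F k l * (F k' l)^* = N%:R *+ (k == k').
Proof.
have [<-|kk'] := eqVneq k k'.
  rewrite (eq_bigr (fun=> 1)) ?sumr_const ?card_ord // => l _.
  exact: dft_mul_conj.
pose z := w ^+ k * (w ^+ k')^*.
have zE (l : 'I_N) : F k l * (F k' l)^* = z ^+ l.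
  by rewrite !dftE /z exprMn -!exprM -rmorphXn -exprM.
have wJ : w * w^* = 1 by rewrite -sqr_normcE normc_expi expr1n rmorph1.
have z1 : z != 1.
  apply: contraNneq kk' => e.
  have /eqP : w ^+ k = w ^+ k'.
    have : z * w ^+ k' = w ^+ k' by rewrite e mul1r.
    by rewrite /z rmorphXn /= -mulrA -exprMn [w^* * w]mulrC wJ expr1n mulr1.
  by rewrite (eq_prim_root_expr dft_root_prim) !modn_small ?ltn_ord.
rewrite (eq_bigr (fun l : 'I_N => z ^+ l)) //.
apply: (mulfI (x := z - 1)); first by rewrite subr_eq0.
rewrite mulr0 -subrX1 /z exprMn -!rmorphXn -!exprM ![(_ * N)%N]mulnC !exprM.
by rewrite (prim_expr_order dft_root_prim) !expr1n rmorph1 mulr1 subrr.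
Qed.

Variable S : {set 'I_N}.
Hypothesis S_gt0 : (0 < #|S|)%N.
Local Notation Phi := (harmonic_frame R S).
Local Notation m := (#|S|%:R : R).

Let m_gt0 : 0 < m. Proof. by rewrite ltr0n. Qed.

Lemma harmonic_frameE a j : Phi a j = F (enum_val a) j / (Num.sqrt m)%:C.
Proof.
rewrite mxE; congr (_ / _%:C); first by rewrite mxE.
rewrite /l2norm; congr Num.sqrt.
rewrite (eq_bigr (fun=> 1)) ?sumr_const ?card_ord // => k _.
by rewrite !mxE normc_expi expr1n.
Qed.

Lemma harmonic_mul_conj a b i j : Phi a i * (Phi b j)^* =
  (m^-1)%:C * (F (enum_val a) i * (F (enum_val b) j)^*).
Proof.
have conjE (x : R[i]) : (x / (Num.sqrt m)%:C)^* = x^* / (Num.sqrt m)%:C.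
  by rewrite rmorphM fmorphV; congr (_ / _); exact: conj_real.
rewrite !harmonic_frameE conjE mulrACA mulrC; congr (_ * _).
by rewrite -invfM -rmorphM -expr2 sqr_sqrtr ?(ltW m_gt0) // fmorphV.
Qed.

Lemma inner_harmonic i j : inner (col i Phi) (col j Phi) =
  (m^-1)%:C * \sum_(k in S) F k i * (F k j)^*.
Proof.
rewrite inner_colE [in RHS]big_enum_val mulr_sumr; apply: eq_bigr => a _.
by rewrite harmonic_mul_conj.
Qed.

Lemma harmonic_coisometry : Phi *m adj Phi = ((N%:R / m)%:C)%:M.
Proof.
apply/matrixP => a b; rewrite gram_rowE mxE.
under eq_bigr do rewrite harmonic_mul_conj.
rewrite -mulr_sumr dft_orthogonal (inj_eq enum_val_inj) mulrnAr.
by rewrite rmorphM /= rmorph_nat mulrC.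
Qed.

Lemma inner_harmonic_diag j : inner (col j Phi) (col j Phi) = 1.
Proof.
rewrite inner_harmonic; under eq_bigr do rewrite dft_mul_conj.
rewrite sumr_const (_ : _ *+ _ = m%:C); last by rewrite rmorph_nat.
by rewrite -rmorphM mulVf ?gt_eqF ?m_gt0.
Qed.

Lemma harmonic_unit_norm j : l2norm (col j Phi) = 1.
Proof.
apply/eqP; rewrite -(@eqrXn2 _ 2) ?l2norm_ge0 // expr1n.
apply/eqP/(@complexI R).
by rewrite sqr_l2norm_col inner_harmonic_diag.
Qed.

(** Summing the Gram entries of column i over all columns j sums each selected
    row of the Fourier matrix, and only row 0 has a nonzero sum.  The term - 1
    removes j = i. *)
Lemma average_coherence_harmonic : average_coherence Phi =
  `|(Ordinal N_gt0 \in S)%:R * (N%:R / m) - 1| / N.-1%:R.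
Proof.
set t := (X in `|X|).
have F0 l : F (Ordinal N_gt0) l = 1 by rewrite dftE mul0n expr0.
have sumE i : \sum_(j < N | j != i) inner (col i Phi) (col j Phi) = t%:C.
  apply: (addrI (inner (col i Phi) (col i Phi))).
  transitivity (\sum_j inner (col i Phi) (col j Phi)).
    by rewrite [RHS](bigD1 i).
  rewrite inner_harmonic_diag addrC.
  under eq_bigr do rewrite inner_harmonic.
  rewrite -mulr_sumr exchange_big /=.
  have rowE k : \sum_(j < N) F k i * (F k j)^* =
      F k i * (N%:R *+ (k == Ordinal N_gt0)).
    rewrite -mulr_sumr; congr (_ * _); rewrite eq_sym -dft_orthogonal.
    by apply: eq_bigr => j _; rewrite F0 mul1r.
  under eq_bigr do rewrite rowE.
  rewrite (eq_bigr (fun k => if k == Ordinal N_gt0 then N%:R else 0)).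
  2: move=> k _; have [->|_] := eqVneq k (Ordinal N_gt0);
    by rewrite ?F0 ?mul1r ?mulr0.
  rewrite -big_mkcondr /= /t rmorphB rmorphM rmorph1 subrK.
  have [S0|S0] := boolP (Ordinal N_gt0 \in S).
    rewrite (big_pred1 (Ordinal N_gt0)) /=.
      by rewrite rmorph1 mul1r rmorphM rmorph_nat mulrC.
    by move=> k /=; have [->|_] := eqVneq k (Ordinal N_gt0); rewrite ?S0 ?andbF.
  rewrite big_pred0 ?mulr0 ?rmorph0 ?mul0r // => k.
  by have [->|] := eqVneq k (Ordinal N_gt0); rewrite ?andbF // (negbTE S0).
have termE i : normc (N.-1%:R^-1 * \sum_(j < N | j != i)
    inner (col i Phi) (col j Phi)) = `|t| / N.-1%:R.
  apply: (@complexI R); rewrite normcE sumE normrM mulrC normfV normr_nat.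
  rewrite rmorphM fmorphV rmorph_nat; congr (_ / _).
  by rewrite normc_def /= expr0n addr0 sqrtr_sqr.
rewrite /average_coherence.
under eq_bigr do rewrite termE.
apply/le_anti/andP; split.
  by apply: bigmax_le => //; rewrite divr_ge0.
exact: (le_bigmax 0 (fun=> `|t| / N.-1%:R) (Ordinal N_gt0)).
Qed.

End Dft.

Section HarmonicCoherence.
Variables (R : realType) (N : nat) (S : {set 'I_N}).
Local Notation normc := ComplexField.Normc.normc.
Local Notation F := (dft R N).
Local Notation Phi := (harmonic_frame R S).
Local Notation m := (#|S|%:R : R).
Hypothesis S_gt0 : (0 < #|S|)%N.

(** With t the numerator of the average coherence, m^2 t^2 is (N - m)^2 or m^2;
    either is at most (N - m) (N - 1) as soon as m <= N/2, and the claim then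
    follows from the Welch bound. *)
Lemma average_coherence_harmonic_le : (1 < N)%N -> 2 * m <= N%:R ->
  average_coherence Phi <= worst_case_coherence Phi / Num.sqrt m.
Proof.
move=> N1 mN; have N0 := ltnW N1.
have m0 : 0 < m by rewrite ltr0n.
have m1 : 1 <= m by rewrite ler1n.
have NR : 2 <= N%:R :> R by rewrite ler_nat.
have n1 : N.-1%:R = N%:R - 1 :> R by rewrite -[in RHS](prednK N0) -natr1 addrK.
have n0 : 0 < N%:R - 1 :> R by lra.
rewrite (average_coherence_harmonic R N0 S_gt0) n1.
set t := (X in `|X|); set W := worst_case_coherence Phi.
have W0 : 0 <= W by rewrite /W /worst_case_coherence bigmax_ge_id.
have key : m ^+ 2 * t ^+ 2 <= (N%:R - m) * (N%:R - 1).
  rewrite /t; case: (_ \in S); last by rewrite mul0r; nra.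
  have -> : m ^+ 2 * (1 * (N%:R / m) - 1) ^+ 2 = (N%:R - m) ^+ 2.
    by rewrite -exprMn mulrBr mul1r mulr1 mulrC divfK ?gt_eqF.
  nra.
have := welch_bound (harmonic_coisometry R N0 S_gt0) S_gt0 N1
  (harmonic_unit_norm R S_gt0).
rewrite n1 -/W => wb.
rewrite ler_pdivlMr ?sqrtr_gt0 // -(@ler_pXn2r _ 2) ?nnegrE //; last first.
  by rewrite mulr_ge0 ?divr_ge0 ?sqrtr_ge0 // ltW.
apply: le_trans wb; rewrite exprMn sqr_sqrtr ?(ltW m0) // expr_div_n.
rewrite real_normK ?num_real //.
have -> : t ^+ 2 / (N%:R - 1) ^+ 2 * m =
    m ^+ 2 * t ^+ 2 / (m * (N%:R - 1) ^+ 2).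
  by field; rewrite !gt_eqF.
have -> : (N%:R - m) / (m * (N%:R - 1)) =
    (N%:R - m) * (N%:R - 1) / (m * (N%:R - 1) ^+ 2).
  by field; rewrite !gt_eqF.
by rewrite ler_pM2r // invr_gt0 mulr_gt0 ?exprn_gt0.
Qed.

Lemma worst_case_coherence_harmonic_le (x : R) : 0 <= x ->
    (forall i j : 'I_N, j != i ->
       normc (\sum_(k in S) F k i * (F k j)^*) <= m * x) ->
  worst_case_coherence Phi <= x.
Proof.
move=> x0 H; apply: bigmax_le => // i _; apply: bigmax_le => // j ji.
have m0 : 0 < m by rewrite ltr0n.
rewrite inner_harmonic // ComplexField.Normc.normcM.
have -> : normc (real_complex R m^-1) = m^-1.
  by rewrite /= expr0n addr0 sqrtr_sqr ger0_norm // invr_ge0 ltW.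
by rewrite mulrC ler_pdivrMr // mulrC H.
Qed.

End HarmonicCoherence.

(** * Random subsets with independent membership *)

Section BernoulliSubsets.
Variables (R : realType) (I : finType) (p : R).
Hypothesis p01 : 0 <= p <= 1.
Local Notation normc := ComplexField.Normc.normc.

Definition subset_weight (S : {set I}) : R :=
  \prod_i (if i \in S then p else 1 - p).

Definition subset_prob (Q : pred {set I}) : R := \sum_(S | Q S) subset_weight S.

Lemma subset_weight_ge0 S : 0 <= subset_weight S.
Proof.
by apply: prodr_ge0 => i _; case: ifP => _; case/andP: p01; rewrite ?subr_ge0.
Qed.

Lemma sum_subset_prod (F G : I -> R) :
  \sum_(S : {set I}) \prod_i (if i \in S then F i else G i) =
  \prod_i (F i + G i).
Proof. by rewrite bigA_distr. Qed.

Lemma subset_prob_setC Q : subset_prob Q = 1 - subset_prob (predC Q).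
Proof.
have : \sum_S subset_weight S = 1.
  by rewrite sum_subset_prod big1 // => i _; rewrite subrKC.
by rewrite (bigID Q) /= => <-; rewrite addrK.
Qed.

Lemma subset_prob_le (Q Q' : pred {set I}) :
  (forall S, Q S -> Q' S) -> subset_prob Q <= subset_prob Q'.
Proof.
move=> QQ'; rewrite /subset_prob big_mkcond [leRHS]big_mkcond.
apply: ler_sum => S _; have := QQ' S; have := subset_weight_ge0 S.
by case: (Q S) => [_ ->//|]; case: (Q' S).
Qed.

Lemma subset_prob_or (Q Q' : pred {set I}) :
  subset_prob (predU Q Q') <= subset_prob Q + subset_prob Q'.
Proof.
rewrite /subset_prob big_mkcond [X in _ <= X + _]big_mkcond.
rewrite [X in _ <= _ + X]big_mkcond -big_split /=.
apply: ler_sum => S _; have := subset_weight_ge0 S.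
by case: (Q S); case: (Q' S) => /= ?; lra.
Qed.

Lemma subset_prob_exists (J : finType) (D : pred J) (Q : J -> pred {set I}) :
  subset_prob [pred S | [exists (j | D j), Q j S]] <=
  \sum_(j | D j) subset_prob (Q j).
Proof.
rewrite /subset_prob.
under [leRHS]eq_bigr do rewrite big_mkcond.
rewrite big_mkcond [leRHS]exchange_big /=; apply: ler_sum => S _.
have w0 := subset_weight_ge0 S.
have t0 j : 0 <= (if Q j S then subset_weight S else 0) by case: ifP.
case: ifP => [/existsP[j /andP[Dj QjS]]|_]; last exact: sumr_ge0.
by rewrite (bigD1 j) //= QjS lerDl sumr_ge0.
Qed.

(** From e^y >= 1 + y one gets e^(-x) >= (1 - x/3)^3.  Splitting x into three
    makes the inverse of this cube sharp enough: (1 - x/3)^3 (1 + x + x^2) - 1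
    is x^2/27 times a cubic that is positive for x <= 1/2. *)
Lemma expR_le_quadratic (x : R) : x <= 1 / 2 -> expR x <= 1 + x + x ^+ 2.
Proof.
move=> x12.
have e3 : expR (- x / 3) ^+ 3 = (expR x)^-1.
  by rewrite -expRM_natl -expRN; congr expR; field.
have y0 : 0 < 1 - x / 3 by lra.
have y1 : (1 - x / 3) ^+ 3 <= (expR x)^-1.
  rewrite -e3 lerXn2r ?nnegrE ?(ltW y0) ?expR_ge0 //.
  by apply: le_trans (expR_ge1Dx _); lra.
have /le_trans -> // : expR x <= ((1 - x / 3) ^+ 3)^-1.
  by rewrite -[leLHS]invrK lef_pV2 ?posrE ?invr_gt0 ?expR_gt0 ?exprn_gt0.
rewrite invf_ple ?posrE ?exprn_gt0 //; last by nra.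
rewrite -[leLHS]mul1r ler_pdivrMr; last by nra.
have q0 : 0 <= 9 - 19 * x + 8 * x ^+ 2 - x ^+ 3.
  have : 0 <= x ^+ 2 * (1 / 2 - x) by rewrite mulr_ge0 ?sqr_ge0 //; lra.
  have := sqr_ge0 (1 / 2 - x); nra.
have : 0 <= x ^+ 2 * (9 - 19 * x + 8 * x ^+ 2 - x ^+ 3).
  by rewrite mulr_ge0 ?sqr_ge0.
lra.
Qed.

(** The exponential moment of y times a centred Bernoulli variable: in the
    quadratic bounds the linear terms cancel, and the quadratic ones add up to
    the variance p (1 - p). *)
Lemma bernoulli_mgf (y : R) : `|y| <= 1 / 2 ->
  p * expR (y * (1 - p)) + (1 - p) * expR (- (p * y)) <=
  expR (y ^+ 2 * (p * (1 - p))).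
Proof.
case/andP: p01 => p0 p1; rewrite ler_norml => /andP[y1 y2].
apply: le_trans (expR_ge1Dx _).
have q0 : 0 <= 1 - p by lra.
have h3 := mulr_ge0 q0 (_ : 0 <= 1 / 2 - y).
have h4 := mulr_ge0 p0 (_ : 0 <= 1 / 2 + y).
have : expR (y * (1 - p)) <= 1 + y * (1 - p) + (y * (1 - p)) ^+ 2.
  by apply: expR_le_quadratic; have := h3 ltac:(lra); lra.
have : expR (- (p * y)) <= 1 + - (p * y) + (- (p * y)) ^+ 2.
  by apply: expR_le_quadratic; have := h4 ltac:(lra); lra.
move=> /(ler_wpM2l q0) h1.
move=> /(ler_wpM2l p0) h2.
apply: le_trans (lerD h2 h1) _; rewrite le_eqVlt; apply/orP; left; apply/eqP.
by ring.
Qed.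

(** Markov's inequality for the exponential moment, which factors over the
    elements because membership is independent.  The bound s <= 1/2 is the
    range of the quadratic estimate of the exponential. *)
Lemma subset_tail (c : I -> R) (s u : R) :
    (forall i, `|c i| <= 1) -> 0 <= s <= 1 / 2 ->
  subset_prob [pred S : {set I} | u <= \sum_(i in S) c i - p * \sum_i c i] <=
  expR (s ^+ 2 * (p * (1 - p) * #|I|%:R) - s * u).
Proof.
move=> c1 /andP[s0 s12].
pose dev (S : {set I}) := \sum_(i in S) c i - p * \sum_i c i.
have devE S : dev S = \sum_i (if i \in S then c i * (1 - p) else - (p * c i)).
  rewrite /dev big_mkcond mulr_sumr -sumrB; apply: eq_bigr => i _.
  by case: ifP => _; ring.
have -> : expR (s ^+ 2 * (p * (1 - p) * #|I|%:R) - s * u) =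
    expR (- (s * u)) * \prod_(i : I) expR (s ^+ 2 * (p * (1 - p))).
  rewrite -expR_sum -expRD sumr_const mulrA -mulr_natr; congr expR; ring.
have mgf i : 0 <=
    p * expR (s * c i * (1 - p)) + (1 - p) * expR (- (p * (s * c i))) <=
    expR (s ^+ 2 * (p * (1 - p))).
  apply/andP; split.
    case/andP: p01 => ? ?.
    by rewrite addr_ge0 // mulr_ge0 ?expR_ge0 // subr_ge0.
  apply: le_trans (bernoulli_mgf _) _.
    rewrite normrM (ger0_norm s0).
    by have := c1 i; have := normr_ge0 (c i); nra.
  rewrite ler_expR ler_wpM2r //; first by case/andP: p01 => ? ?; nra.
  rewrite exprMn ler_piMr ?sqr_ge0 // -[c i ^+ 2]ger0_norm ?sqr_ge0 // normrX.
  by rewrite exprn_ile1.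
have /(ler_wpM2l (expR_ge0 (- (s * u)))) := ler_prod (index_enum I)
  (fun i (_ : true) => mgf i).
apply: le_trans.
rewrite -sum_subset_prod [leRHS]mulr_sumr /subset_prob big_mkcond.
apply: ler_sum => S _.
have -> : expR (- (s * u)) * \prod_i
    (if i \in S then p * expR (s * c i * (1 - p))
     else (1 - p) * expR (- (p * (s * c i)))) =
    subset_weight S * expR (s * (dev S - u)).
  rewrite [s * (dev S - u)]mulrBr [s * dev S + _]addrC expRD [RHS]mulrCA.
  congr (_ * _).
  rewrite devE mulr_sumr expR_sum /subset_weight -big_split.
  apply: eq_bigr => i _ /=.
  by case: ifP => _; congr (_ * expR _); ring.
have w0 := subset_weight_ge0 S.
case: ifP => /= [uS|_]; last by rewrite mulr_ge0 ?expR_ge0.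
by rewrite ler_peMr // -expR0 ler_expR mulr_ge0 // subr_ge0.
Qed.

Lemma subset_tail_norm (c : I -> R) (s u : R) :
    (forall i, `|c i| <= 1) -> 0 <= s <= 1 / 2 ->
  subset_prob
    [pred S : {set I} | u <= `|\sum_(i in S) c i - p * \sum_i c i|] <=
  2 * expR (s ^+ 2 * (p * (1 - p) * #|I|%:R) - s * u).
Proof.
move=> c1 s01; rewrite mulr_natl mulr2n.
apply: le_trans (lerD (subset_tail u c1 s01)
  (subset_tail u (c := -%R \o c) _ s01)).
  apply: le_trans (subset_prob_or _ _); apply: subset_prob_le => S /=.
  by rewrite ler_normr !sumrN mulrN opprB [- _ - _]addrC opprK addrC.
by move=> i /=; rewrite normrN.
Qed.

Lemma Re_sum (J : Type) (r : seq J) (Q : pred J) (f : J -> R[i]) :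
  complex.Re (\sum_(j <- r | Q j) f j) = \sum_(j <- r | Q j) complex.Re (f j).
Proof. by apply: (big_morph (@complex.Re R)) => // [[? ?] [? ?]]. Qed.

Lemma Im_sum (J : Type) (r : seq J) (Q : pred J) (f : J -> R[i]) :
  complex.Im (\sum_(j <- r | Q j) f j) = \sum_(j <- r | Q j) complex.Im (f j).
Proof. by apply: (big_morph (@complex.Im R)) => // [[? ?] [? ?]]. Qed.

(** A complex number of squared modulus at least 2 u^2 has a real or imaginary
    part of absolute value at least u. *)
Lemma subset_tail_normc (z : I -> R[i]) (s u : R) :
    (forall i, normc (z i) <= 1) -> \sum_i z i = 0 ->
    0 <= s <= 1 / 2 -> 0 <= u ->
  subset_prob
    [pred S : {set I} | 2 * u ^+ 2 <= normc (\sum_(i in S) z i) ^+ 2] <=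
  4 * expR (s ^+ 2 * (p * (1 - p) * #|I|%:R) - s * u).
Proof.
move=> z1 z0 s01 u0.
have z2 i : complex.Re (z i) ^+ 2 + complex.Im (z i) ^+ 2 <= 1.
  have := z1 i; case: (z i) => a b /= h.
  have ab : 0 <= a ^+ 2 + b ^+ 2 by rewrite addr_ge0 ?sqr_ge0.
  by rewrite -(sqr_sqrtr ab) expr_le1 ?sqrtr_ge0.
have Re1 i : `|complex.Re (z i)| <= 1.
  rewrite -(@expr_le1 _ 2) // real_normK ?num_real //.
  by have := z2 i; have := sqr_ge0 (complex.Im (z i)); lra.
have Im1 i : `|complex.Im (z i)| <= 1.
  rewrite -(@expr_le1 _ 2) // real_normK ?num_real //.
  by have := z2 i; have := sqr_ge0 (complex.Re (z i)); lra.
have -> : 4 = 2 + 2 :> R by ring.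
rewrite [(2 + 2) * _]mulrDl.
apply: le_trans (lerD (subset_tail_norm u Re1 s01)
  (subset_tail_norm u Im1 s01)).
apply: le_trans (subset_prob_or _ _); apply: subset_prob_le => S /=.
rewrite -!Re_sum -!Im_sum z0 /= mulr0 !subr0.
case: (\sum_(i in S) z i) => a b /=.
rewrite sqr_sqrtr ?addr_ge0 ?sqr_ge0 // => h.
have sqr_lt x : `|x| < u -> x ^+ 2 < u ^+ 2.
  by move=> xu; rewrite -(real_normK (num_real x)) ltr_pXn2r // ?nnegrE.
have [//|/sqr_lt ua] := leP u `|a|; have [//|/sqr_lt ub /=] := leP u `|b|.
by move: h; lra.
Qed.

End BernoulliSubsets.

Section SelectedSet.
Context (d : measure_display) (T : measurableType d) (R : realType).
Context (P : probability T R) (N : nat) (p : R) (B : 'I_N -> {RV P >-> R}).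
Hypothesis B_bernoulli : forall i, bernoulli_variable p (B i).
Hypothesis B_indep : mutually_independent B.

Lemma bernoulli_prob_eq1 i : P (B i @^-1` [set 1]) = p%:E.
Proof.
have [B01 <-] := B_bernoulli i.
have m1 : measurable (B i @^-1` [set 1]) by exact: measurable_funPTI.
rewrite -(expectation_indic P m1); congr expectation; apply/funext => w.
rewrite indicE; case: (B01 w) => Bw; rewrite Bw.
  by rewrite memNset //= Bw => /eqP; rewrite eq_sym oner_eq0.
by rewrite mem_set.
Qed.

Definition selected_eq (S : {set 'I_N}) : set T := [set w | selected B w = S].

Lemma selected_eqE S : selected_eq S =
  \bigcap_(i in [set` finset.setTfor 'I_N])
     (B i @^-1` (if i \in S then [set 1] else ~` [set 1])).
Proof.
apply/seteqP; split => [w /= <- i _|w /= H].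
  rewrite inE; case: ifPn => /eqP //.
apply/setP => i; have := H i; rewrite inE /= !inE => /(_ isT).
by case: ifP => _ /eqP // /negbTE.
Qed.

Lemma measurable_selected_eq S : measurable (selected_eq S).
Proof.
rewrite selected_eqE; apply: fin_bigcap_measurable; first exact: finite_finset.
move=> i _; apply: measurable_funPTI; case: ifP => _ //.
exact: measurableC.
Qed.

Lemma prob_selected_eq S : P (selected_eq S) = (subset_weight p S)%:E.
Proof.
rewrite selected_eqE B_indep; last first.
  by move=> i; case: ifP => _ //; exact: measurableC.
rewrite /subset_weight -prodEFin big_mkcond; apply: eq_bigr => i _.
rewrite inE /=; case: ifP => _; first exact: bernoulli_prob_eq1.
by rewrite -preimage_setC probability_setC ?bernoulli_prob_eq1.
Qed.

(** Any event that depends only on the selected set is a finite disjoint union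
    of the events that fix this set. *)
Lemma prob_selected (Q : pred {set 'I_N}) :
  P [set w | Q (selected B w)] = (subset_prob p Q)%:E.
Proof.
have -> : [set w | Q (selected B w)] = \bigcup_(S in [set` Q]) selected_eq S.
  apply/seteqP; split => [w /= QS|w [S QS /= ->]//].
  by exists (selected B w).
rewrite measure_fin_bigcup.
- rewrite /subset_prob -sumEFin.
  rewrite (bigfs _ (r := index_enum _)) ?index_enum_uniq //.
    by apply: eq_fsbigr => S _; exact: prob_selected_eq.
  by move=> S _; rewrite mem_index_enum.
- exact: finite_finset.
- by move=> S S' _ _ [w [<- <-]].
- by move=> S _; exact: measurable_selected_eq.
Qed.

End SelectedSet.

(** * The three coherence conditions *)

Section GoodSubsets.
Variables (R : realType) (N : nat) (M : R).
Local Notation normc := ComplexField.Normc.normc.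
Local Notation F := (dft R N).
Local Notation L := (@ln R N%:R).
Local Notation p := (M / N%:R).

Definition good_subset : pred {set 'I_N} := fun S =>
  let m : R := #|S|%:R in
  let Phi := harmonic_frame R S in
  [&& 2^-1 * M <= m <= 3 / 2 * M,
      average_coherence Phi <= worst_case_coherence Phi / Num.sqrt m
    & worst_case_coherence Phi <=
      Num.sqrt (118 * (N%:R - M) * L / (M * N%:R))].

Hypotheses (N_gt4 : (4 < N)%N) (ML : 16 * L <= M) (MN : M <= N%:R / 3).

Let N_gt0 : (0 < N)%N. Proof. by apply: leq_trans N_gt4. Qed.
Let NR : 5 <= N%:R :> R. Proof. by rewrite ler_nat. Qed.
Let L_gt0 : 0 < L. Proof. by apply: ln_gt0; move: NR; lra. Qed.
Let M_gt0 : 0 < M. Proof. by move: L_gt0 ML; lra. Qed.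
Let NR_gt0 : 0 < N%:R :> R. Proof. by move: NR; lra. Qed.

Let p01 : 0 <= p <= 1.
Proof.
rewrite divr_ge0 ?(ltW M_gt0) ?(ltW NR_gt0) //= ler_pdivrMr //.
by move: NR MN; lra.
Qed.

(** The variance of the number of selected rows. *)
Let v : R := p * (1 - p) * N%:R.

Lemma varianceE : v = M * (N%:R - M) / N%:R.
Proof. by rewrite /v; field; rewrite gt_eqF. Qed.

Lemma variance_le : v <= M.
Proof. by rewrite varianceE ler_pdivrMr //; move: NR M_gt0 MN; nra. Qed.

Lemma variance_ge : 2 / 3 * M <= v.
Proof. by rewrite varianceE ler_pdivlMr //; move: NR M_gt0 MN; nra. Qed.

Let r := Num.sqrt (v * L).

Lemma sqr_scale : r ^+ 2 = v * L.
Proof.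
by rewrite sqr_sqrtr // mulr_ge0 ?(ltW L_gt0) //; move: variance_ge M_gt0; lra.
Qed.

Definition unbalanced : pred {set 'I_N} := fun S =>
  M / 2 <= `|\sum_(i in S) (1 : R) - p * \sum_(i < N) 1|.

(** The factor 96/25 is a rational just below sqrt (118/8): twice its square is
    less than 118/4, so that avoiding this event for all pairs yields the
    coherence bound with constant 118 when m >= M/2.  See [good_subsetP]. *)
Definition correlated (ij : 'I_N * 'I_N) : pred {set 'I_N} := fun S =>
  2 * (96 / 25 * r) ^+ 2 <= normc (\sum_(k in S) F k ij.1 * (F k ij.2)^*) ^+ 2.

Lemma prob_unbalanced : subset_prob p unbalanced <= 2 / N%:R.
Proof.
have := @subset_tail_norm R 'I_N p p01 (fun=> 1) (1 / 4) (M / 2).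
rewrite normr1 card_ord -/v => /(_ (fun=> lexx _)) H.
apply: le_trans (H _) _; first lra.
rewrite ler_pM2l // -[leRHS]lnK ?posrE ?invr_gt0 // lnV ?posrE // ler_expR.
by move: variance_le ML; lra.
Qed.

(** With r^2 = v L and s = (3/2) r/v, the exponent s^2 v - s (96/25) r equals
    (9/4 - 144/25) L = - 3.51 L, and s <= 1/2 because v >= 2M/3 >= 9 L.  The
    part exp (- L/2) <= 1/2 of the resulting bound turns 4/N^3 into 2/N^3. *)
Lemma prob_correlated (ij : 'I_N * 'I_N) : ij.2 != ij.1 ->
  subset_prob p (correlated ij) <= 2 / N%:R ^+ 3.
Proof.
move=> ij_neq.
have v0 : 0 < v by move: variance_ge M_gt0; lra.
have r0 : 0 <= r by exact: sqrtr_ge0.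
pose s := 3 / 2 * (r / v).
have rv : r / v <= 1 / 3.
  rewrite ler_pdivrMr // -(@ler_pXn2r _ 2) ?nnegrE //; last by nra.
  by rewrite sqr_scale exprMn; move: variance_ge ML; nra.
have s01 : 0 <= s <= 1 / 2.
  by have := divr_ge0 r0 (ltW v0); rewrite /s; lra.
have z0 : \sum_k F k ij.1 * (F k ij.2)^* = 0.
  rewrite -[RHS](mulr0n (N%:R)) -[X in _ *+ X]/(nat_of_bool false).
  rewrite -(negbTE ij_neq) eq_sym -dft_orthogonal //.
  by apply: eq_bigr => k _; rewrite !(dft_sym _ k).
have := @subset_tail_normc R 'I_N p p01 (fun k => F k ij.1 * (F k ij.2)^*) s
  (96 / 25 * r).
rewrite card_ord -/v => H; apply: le_trans (H _ z0 s01 _) _.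
- move=> k; rewrite ComplexField.Normc.normcM normc_dft mul1r.
  rewrite -lecR normcE norm_conjC -normcE lecR normc_dft //.
- by lra.
have -> : s ^+ 2 * v - s * (96 / 25 * r) = - (351 / 100 * L).
  have -> : s ^+ 2 * v - s * (96 / 25 * r) = - (351 / 100) * (r ^+ 2 / v).
    by rewrite /s; field; rewrite gt_eqF.
  by rewrite sqr_scale mulrAC divff ?gt_eqF // mul1r mulNr.
have NR5 := NR.
have eL : expR (- (1 / 2 * L)) <= 1 / 2.
  rewrite -(@ler_pXn2r _ 2) ?nnegrE ?expR_ge0 //.
  rewrite -expRM_natl (_ : _ * _ = - L); last by field.
  rewrite expRN lnK ?posrE // invf_ple ?posrE //; lra.
have e3 : expR (- (3 * L)) = (N%:R ^+ 3)^-1.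
  by rewrite expRN -[3]/(3%:R) expRM_natl lnK ?posrE.
apply: (@le_trans _ _ (4 * (expR (- (3 * L)) * expR (- (1 / 2 * L))))).
  by rewrite ler_pM2l // -expRD ler_expR; move: L_gt0; lra.
rewrite e3; set q := (N%:R ^+ 3)^-1.
have q0 : 0 < q by rewrite invr_gt0 exprn_gt0.
nra.
Qed.

Lemma good_subsetP S : ~~ unbalanced S ->
    ~~ [exists (ij : 'I_N * 'I_N | ij.2 != ij.1), correlated ij S] ->
  good_subset S.
Proof.
rewrite /unbalanced sumr_const sumr_const card_ord divfK ?gt_eqF // -ltNge.
set m : R := #|S|%:R; rewrite ltr_norml => /andP[mM1 mM2].
have m0 : (0 < #|S|)%N by rewrite -(ltr0n R) -/m; move: M_gt0; lra.
rewrite negb_exists => /forallP uncorr.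
rewrite /good_subset -/m; apply/and3P; split.
- by apply/andP; split; lra.
- apply: average_coherence_harmonic_le => //; first by apply: leq_trans N_gt4.
  by rewrite -/m; move: MN mM2; lra.
set X := 118 * _ * _ / _.
have XE : M ^+ 2 * X = 118 * (v * L).
  rewrite /X varianceE; field; by rewrite !gt_eqF.
have v0 : 0 < v by move: variance_ge M_gt0; lra.
have X0 : 0 <= X.
  rewrite -(pmulr_rge0 _ (exprn_gt0 2 M_gt0)) XE.
  by apply: mulr_ge0; rewrite // mulr_ge0 ?(ltW v0) ?(ltW L_gt0).
apply: worst_case_coherence_harmonic_le => //.
move=> i j ji; rewrite -/m -(@ler_pXn2r _ 2) ?nnegrE ?normc_ge0 //; last first.
  by rewrite mulr_ge0 ?sqrtr_ge0.
have := uncorr (i, j); rewrite /= ji /= /correlated -ltNge /= => /ltW /le_trans.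
apply; rewrite !exprMn sqr_scale sqr_sqrtr //.
have : M ^+ 2 * X <= 4 * m ^+ 2 * X.
  by rewrite ler_wpM2r //; move: M_gt0 mM1; nra.
by rewrite XE; have := mulr_ge0 (ltW v0) (ltW L_gt0); lra.
Qed.

Lemma prob_good_subset : 1 - 4 / N%:R <= subset_prob p good_subset.
Proof.
rewrite subset_prob_setC // lerD2l lerN2.
have -> : 4 / N%:R = 2 / N%:R + 2 / N%:R :> R by field; rewrite gt_eqF.
pose bad := predU unbalanced
  [pred S | [exists (ij : 'I_N * 'I_N | ij.2 != ij.1), correlated ij S]].
apply: (@le_trans _ _ (subset_prob p bad)).
  apply: subset_prob_le => // S; apply: contraR.
  by rewrite negb_or => /andP[? ?]; exact: good_subsetP.
apply: le_trans (subset_prob_or p01 _ _) _; rewrite lerD ?prob_unbalanced //.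
apply: le_trans (subset_prob_exists p01 _ _) _.
apply: (@le_trans _ _ (\sum_(ij : 'I_N * 'I_N) 2 / N%:R ^+ 3)).
  rewrite big_mkcond; apply: ler_sum => ij _.
  by case: ifP => [/prob_correlated //|_]; rewrite divr_ge0 ?exprn_ge0 ?ler0n.
rewrite sumr_const card_prod card_ord -[_ *+ (N * N)]mulr_natl natrM.
rewrite le_eqVlt; apply/orP; left; apply/eqP; field; by rewrite gt_eqF.
Qed.

End GoodSubsets.

Theorem theorem51 (R : realType) (d : measure_display) (T : measurableType d)
    (P : probability T R) (N : nat) (M : R) (B : 'I_N -> {RV P >-> R})
    (N_gt0 : (0 < N)%N)
    (B_bernoulli : forall i, bernoulli_variable (M / N%:R) (B i))
    (B_indep : mutually_independent B) :
  (forall w : T, selected B w != finset.set0 ->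
     let Phi := harmonic_frame R (selected B w) in
     unit_norm_tight_frame Phi /\
     spectral_norm Phi ^+ 2 = N%:R / #|selected B w|%:R) /\
  (16 * ln N%:R <= M <= N%:R / 3 ->
     ((1 - 4 * N%:R^-1 - N%:R ^- 2)%:E <
      P [set w : T |
          let m : R := #|selected B w|%:R in
          let Phi := harmonic_frame R (selected B w) in
          [/\ 2^-1 * M <= m <= 3 / 2 * M,
              average_coherence Phi <= worst_case_coherence Phi / Num.sqrt m
            & worst_case_coherence Phi <=
              Num.sqrt (118 * (N%:R - M) * ln N%:R / (M * N%:R))]%R])%E).
Proof.
split=> [w|/andP[ML MN]].
  rewrite -card_gt0 => S_gt0 Phi.
  have NS_gt0 : 0 < N%:R / #|selected B w|%:R :> R by rewrite divr_gt0 ?ltr0n.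
  have AAc := harmonic_coisometry R N_gt0 S_gt0.
  split; last exact: (spectral_norm_coisometry AAc).
  apply: (unit_norm_tight_frame_coisometry AAc NS_gt0).
  exact: harmonic_unit_norm.
have NR : 0 < N%:R :> R by rewrite ltr0n.
have N2 : 0 < N%:R ^- 2 :> R by rewrite invr_gt0 exprn_gt0.
set good := [set w | _].
have [N_le4|N_gt4] := leqP N 4.
  apply: (@lt_le_trans _ _ 0%E); last exact: measure_ge0.
  rewrite lte_fin; apply: (@le_lt_trans _ _ (0 - N%:R ^- 2)); last by lra.
  by rewrite lerD2r subr_le0 ler_pdivlMr // mul1r (ler_nat R _ 4).
have -> : good = [set w | good_subset M (selected B w)].
  by apply/seteqP; split=> w /and3P.
rewrite (prob_selected B_bernoulli B_indep) lte_fin.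
by apply: lt_le_trans (prob_good_subset N_gt4 ML MN); lra.
Qed.
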